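(* Let $n\ge 1$, let $\pi$ be a $231$-avoiding permutation of $\{1,\ldots,n\}$, let $D(\pi)$ be the Dyck tiling of the region $R$ corresponding to $\pi$, and let $\rho(\pi)$ be the Dyck path of size $n$ attached to $\pi$ (both described in the context). Then $$\mathrm{maj}(D(\pi))=\mathrm{maj}(\rho(\pi)).$$
   Context: **Permutations and Dyck paths.** $\pi=\pi_1\cdots\pi_n$ is $231$-avoiding if there are no $i<j<k$ with $\pi_k<\pi_i<\pi_j$. A Dyck path of size $n$ is a word $p_1\cdots p_{2n}$ in $\{0,1\}$ with $n$ letters $0$ and $n$ letters $1$ in which every prefix contains at least as many $0$'s as $1$'s. Its major index $\mathrm{maj}(p)$ is the sum of all $1\le i\le 2n-1$ with $p_i>p_{i+1}$. **The map $\rho$.** Put $\mathrm{Des}(\pi):=\{1\le i\le n-1:\pi_i>\pi_{i+1}\}\cup\{n\}$ and $\mathrm{iDes}(\pi):=\mathrm{Des}(\pi^{-1})$. For a $231$-avoiding $\pi$ these sets have the same cardinality $m$ (known fact); write $\mathrm{Des}(\pi)=\{i_1<\cdots<i_m\}$, $\mathrm{iDes}(\pi)=\{j_1<\cdots<j_m\}$. Then $$\rho(\pi):=0^{i_m-i_{m-1}}1^{j_m-j_{m-1}}\cdots0^{i_2-i_1}1^{j_2-j_1}0^{i_1}1^{j_1},$$ which is a Dyck path of size $n$; $\rho$ is a bijection from $231$-avoiding permutations to Dyck paths of size $n$. **The region $R$.** In the plane, $0$ denotes a step $(1,1)$ and $1$ a step $(1,-1)$. Let $\lambda_b=(01)^n$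 start at $(0,0)$ and end at $(2n,0)$, and let $\lambda_t=1^{2n}$ start at $(0,2n)$ and end at $(2n,0)$. The region $R$ bounded by $\lambda_b$, $\lambda_t$ and $x=0$ is filled with unit squares rotated by 45 degrees, the square with center $(x,y)$ having vertices $(x\pm1,y)$, $(x,y\pm1)$; the squares are those with integer centers $(x,y)$, $x\ge 0$, $y\ge 1$, $x+y$ odd, $x+y\le 2n-1$. The squares centered on $x=0$ are called anchor boxes and are labeled $1,\ldots,n$ from top to bottom, so the anchor box labeled $i$ has center $(0,2(n-i)+1)$. **Dyck tilings.** A Dyck tile is a ribbon (connected skew shape of squares with no $2\times2$ block of squares) such that the line joining consecutive centers of its squares is a Dyck path (starting and ending at the same height, with steps $(1,1)$ and $(1,-1)$, never going below its starting height). A single square is the trivial Dyck tile; others are non-trivial. A Dyck tiling of $R$ is a tiling $D$ of the squares of $R$ by Dyck tiles which is cover-inclusive: for each tile $d$ of $D$, the translate of $d$ by $(0,-2)$ is contained in another tile of $D$ or is below $\lambda_b$. **Tilings and permutations.** The entry of a tile is the north-west edge of its left-most square and its exit is the south-east edge of its right-most square; the tile carries a trajectory running inside it from entry to exit. For each $i$, start at the entry of the tile containing the anchor box labeled $i$ and follow its trajectory; whenever the exit reached coincides with the entry of another tile, continue along that tile's trajectory. The trajectory ends when the exit coincides with an up step of $\lambda_b$, or with an up step (edge in direction $(1,1)$) of the boundary of another tile which is not that tile's entry. In the first case write $i$ below the peak of $\lambda_b$ at the end of that up step; in the second case write $i$ below the peak of $\lambda_b$ lying vertically below that edge (the peak ending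 the up step of $\lambda_b$ obtained by translating the edge vertically downward). This places each of $1,\ldots,n$ below exactly one of the $n$ peaks of $\lambda_b$, and reading the integers at the peaks from right to left gives a permutation. This is a bijection between Dyck tilings of $R$ and permutations of $\{1,\ldots,n\}$; $D(\pi)$ is the Dyck tiling whose permutation is $\pi$. **Major index of a tiling.** For a tile $d$ with $N(d)$ squares let $l(d):=0$ if $d$ is trivial and $l(d):=(N(d)+1)/2$ otherwise. Let $(x(d),y(d))$ be the left-most point of the Dyck path of $d$, i.e. the center of the left-most square of $d$. Set $\mathrm{maj}(d):=0$ if $d$ is trivial, and $\mathrm{maj}(d):=l(d)+x(d)+(y(d)-1)/2$ otherwise. Finally $\mathrm{maj}(D):=\sum_{d\in D}\mathrm{maj}(d)$, the sum over all tiles of $D$. *)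

(* Defs.v *)
From mathcomp Require Import all_boot all_order all_algebra all_fingroup.
From mathcomp Require Import finmap.
Set Implicit Arguments.
Unset Strict Implicit.
Unset Printing Implicit Defensive.
Import Order.TTheory GRing.Theory Num.Theory.
Local Open Scope ring_scope.

(* A permutation of {1,...,n} is an element of 'S_n: the position and the value
   written i and pi_i in 1-based notation are i.-1 and pi_i.-1 here. *)

Definition avoids231 n (pi : 'S_n) : Prop :=
  forall i j k : 'I_n, (i < j)%N -> (j < k)%N -> ~~ (pi k < pi i < pi j)%N.

(* The word pi_1 ... pi_n, with values in {1,...,n}. *)
Definition oneline n (pi : 'S_n) : seq nat := [seq (pi i).+1 | i <- enum 'I_n].

(* The element i_k of Des(pi) = {i_1 < ... < i_m} is the entry k.-1. *)
Definition Des n (pi : 'S_n) : seq nat :=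
  [seq i <- iota 1 n
     | (i == n) || (nth 0 (oneline pi) i < nth 0 (oneline pi) i.-1)%N].

Definition iDes n (pi : 'S_n) : seq nat := Des (pi^-1)%g.

(* With i_0 = j_0 = 0, the block k is 0^(i_(k+1) - i_k) 1^(j_(k+1) - j_k). *)
Definition rho_block n (pi : 'S_n) (k : nat) : seq nat :=
  let I := 0%N :: Des pi in
  let J := 0%N :: iDes pi in
  nseq (nth 0 I k.+1 - nth 0 I k)%N 0%N ++ nseq (nth 0 J k.+1 - nth 0 J k)%N 1%N.

Definition rho n (pi : 'S_n) : seq nat :=
  flatten [seq rho_block pi k | k <- rev (iota 0 (size (Des pi)))].

Definition maj_word (p : seq nat) : nat :=
  (\sum_(1 <= i < size p | nth 0 p i < nth 0 p i.-1) i)%N.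

(* A square is given by its center. *)
Definition square : Type := (int * int)%type.

Definition region (n : nat) : pred square := fun s =>
  [&& 0 <= s.1, 1 <= s.2, ((s.1 + s.2) %% 2)%Z == 1 & s.1 + s.2 <= (2 * n)%:Z - 1].

(* The anchor box labeled i.+1. *)
Definition anchor n (i : 'I_n) : square := (0, (2 * (n - i.+1) + 1)%:Z).

(* A tile is the sequence of its squares from left to right. *)
Definition tile : Type := seq square.

Definition dyck_step : rel square := fun s s' =>
  (s'.1 == s.1 + 1) && ((s'.2 == s.2 + 1) || (s'.2 == s.2 - 1)).

(* A set of squares whose centers are successively joined by steps (1,1) and
   (1,-1) is automatically a ribbon. *)
Definition is_dyck_tile (d : tile) : bool :=
  if d is s :: d' then
    [&& path dyck_step s d', (last s d').2 == s.2 & all (fun s' => s.2 <= s'.2) d']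
  else false.

Definition leftmost (d : tile) : square := head (0, 0) d.
Definition rightmost (d : tile) : square := last (0, 0) d.

Definition down2 (s : square) : square := (s.1, s.2 - 2).

(* The path (01)^n has height x %% 2 at abscissa x, so the condition says that
   the top vertex of the square is weakly below it; the other vertices then are
   too. *)
Definition below_lambda_b (s : square) : bool := s.2 + 1 <= (s.1 %% 2)%Z.

Definition cover_inclusive (D : {fset tile}) : Prop :=
  forall d, d \in D ->
    (exists d', [/\ d' \in D, d' != d & {subset map down2 d <= d'}])
    \/ all below_lambda_b (map down2 d).

Definition dyck_tiling (n : nat) (D : {fset tile}) : Prop :=
  [/\ forall d, d \in D -> is_dyck_tile d,
      forall s, region n s <-> exists2 d, d \in D & s \in d,
      forall s d d', d \in D -> d' \in D -> s \in d -> s \in d' -> d = d'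
    & cover_inclusive D].

(* An edge in direction (1,1) is given by its lower left end point. *)
Definition edge : Type := (int * int)%type.
Definition nw_edge (s : square) : edge := (s.1 - 1, s.2).
Definition se_edge (s : square) : edge := (s.1, s.2 - 1).

Definition entry (d : tile) : edge := nw_edge (leftmost d).
Definition exit (d : tile) : edge := se_edge (rightmost d).

(* The edge e is the SE edge of the square (e.1, e.2 + 1) and the NW edge of the
   square (e.1 + 1, e.2); it bounds d when exactly one of them is in d. *)
Definition on_boundary (d : tile) (e : edge) : bool :=
  ((e.1, e.2 + 1) \in d) (+) ((e.1 + 1, e.2) \in d).

(* The up step of (01)^n leading to its peak k, with peaks numbered from 0 from
   left to right. *)
Definition lambda_b_up n (k : 'I_n) : edge := ((2 * k)%:Z, 0).

Definition follows (D : {fset tile}) : rel tile := fun d d' =>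
  [&& d' \in D, d' != d & entry d' == exit d].

Definition ends_below n (D : {fset tile}) (d : tile) (k : 'I_n) : Prop :=
  exit d = lambda_b_up k
  \/ exists d', [/\ d' \in D, d' != d, on_boundary d' (exit d),
                    exit d != entry d' & (exit d).1 = (lambda_b_up k).1].

(* The label i.+1 is written below the peak k. *)
Definition label_at n (D : {fset tile}) (i k : 'I_n) : Prop :=
  exists d ds, [/\ d \in D, anchor i \in d, path (follows D) d ds
                 & ends_below D (last d ds) k].

(* rev_ord: the labels are read from right to left. *)
Definition tiling_perm n (D : {fset tile}) (pi : 'S_n) : Prop :=
  forall j : 'I_n, label_at D (pi j) (rev_ord j).

(* Values in rat, so that the halves need no integrality argument. *)
Definition tile_l (d : tile) : rat :=
  if size d == 1%N then 0 else (size d).+1%:R / 2.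

Definition tile_maj (d : tile) : rat :=
  if size d == 1%N then 0
  else tile_l d + (leftmost d).1%:~R + ((leftmost d).2 - 1)%:~R / 2.

Definition tiling_maj (D : {fset tile}) : rat := \sum_(d <- D) tile_maj d.

(* Main.v *)
Require Import Defs.
From mathcomp Require Import all_boot all_order all_algebra all_fingroup.
From mathcomp Require Import finmap zify.
Import GRing.Theory Num.Theory.
Set Implicit Arguments.
Unset Strict Implicit.
Unset Printing Implicit Defensive.
Local Open Scope ring_scope.

(** The squares of the region fall into rows, whose centers form zigzags parallel to
    the lower boundary [(01)^n]. Let the node [b] of a row be its square of abscissa
    [2 * b]: its south-east edge lies above the up step leading to peak [b].
    Cover-inclusivity puts every tile inside a single row ([tile_in_row]), and makes
    nodes [b] and [b + 1] that are merged, that is, lie in one tile in some row,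
    merged in all lower rows as well. A tiling is therefore the sequence of its
    heights, [height b] being the number of rows where nodes [b] and [b + 1] are
    merged.

    A trajectory at node [b] of row [j] stays in row [j] if [j < height b], stops if
    [j = height b], and drops to row [j - 1] if [j > height b]. This is the
    decoding of a Lehmer code. Writing [w b] for the row where the label found below
    peak [b] starts, [height b] is the number of [b' > b] with [w b' < w b]
    ([height_code]). The word [w] is the
    reverse-complement of [pi], so it avoids 312 when [pi] avoids 231.

    A tile of row [j] going from node [a] to node [e > a] has major index
    [a + e + 1 + j] ([tile_maj_row_run]). As [w] avoids 312, its code exceeds the
    next one by exactly one at a descent, and does not exceed it at an ascent.
    Hence every descent [w (e - 1) > w e] is the right end of exactly one
    nontrivial tile, every nontrivial tile arises so, its row is [j = height e],
    and its left end [a] satisfies [w e = a + j] ([row_run_spec],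
    [nontrivial_tiles]). The tiling thus has major index
    [\sum_e (e + w e + 1)] over the descents [e] of [w].

    In [rho pi] a factor 10 occurs exactly between consecutive blocks, which gives
    the major index [\sum_(i in Des) (n - i) + \sum_(j in iDes) (n - j)]
    ([maj_rho]). For a 231-avoiding [pi], the elements of [iDes] other than [n] are
    one less than the values at the tops of the descents of [pi]
    ([perm_iDes_tops]). For the descent [i = n - e] of [pi], the summand [n - i] is
    [e], and the element [j] of [iDes] given by its top has [n - j = w e + 1]. *)

(** * The major index of the word attached to a permutation *)

Section Words.
Local Open Scope nat_scope.

Lemma maj_word_cat_block (w : seq nat) (a b : nat) :
  0 < a -> 0 < b -> last 1 w = 1 ->
  maj_word (w ++ (nseq a 0 ++ nseq b 1)) = maj_word w + size w.
Proof.
move=> a0 b0 lw; rewrite /maj_word !size_cat !size_nseq.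
have blk k : nth 0 (nseq a 0 ++ nseq b 1) k = (a <= k < a + b) :> nat.
  rewrite nth_cat size_nseq !nth_nseq.
  case: (ltnP k a) => // ak; have -> : (k - a < b) = (k < a + b) by lia.
  by case: (k < a + b).
have ltb (x y : bool) : (x < y) = ~~ x && y by case: x y => [] [].
case: (posnP (size w)) => [/size0nil -> /=|w0].
  rewrite [X in _ = X + _]big_geq // addn0 add0n big_nat_cond big1 // => i.
  rewrite /= !blk ltb; lia.
rewrite (big_cat_nat w0) /=; last by lia.
rewrite (@big_cat_nat _ _ _ (size w).+1 (size w)) /=; [|lia|lia].
rewrite [X in _ + (_ + X)]big_nat_cond [X in _ + (_ + X)]big1 => [|i].
  rewrite addn0; congr addn; last first.
    rewrite big_mkcond big_nat1 !(nth_cat 0 w) ltnn subnn blk.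
    rewrite (_ : (size w).-1 < size w); last by lia.
    have -> : nth 0 w (size w).-1 = 1.
      by rewrite nth_last; case: (w) w0 lw.
    by rewrite (leqNgt a) a0.
  rewrite big_nat_cond [RHS]big_nat_cond; apply: eq_bigl => i.
  apply: andb_id2l => iw; rewrite !(nth_cat 0 w).
  have -> : i < size w by lia.
  by have -> : i.-1 < size w by lia.
rewrite !(nth_cat 0 w).
case: ifP => [|_]; first by lia.
case: ifP => [|_]; first by lia.
rewrite !blk ltb; lia.
Qed.

Section Rho.
Context (n : nat) (pi : 'S_n).
Hypothesis n0 : 0 < n.

Lemma mem_Des (s : 'S_n) i : (i \in Des s) =
  (0 < i <= n) && ((i == n) || (nth 0 (oneline s) i < nth 0 (oneline s) i.-1)).
Proof. by rewrite mem_filter mem_iota andbC; congr andb; lia. Qed.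

Lemma sorted_Des (s : 'S_n) : sorted ltn (0 :: Des s).
Proof.
rewrite /= (path_sortedE ltn_trans); apply/andP; split.
  by apply/allP => i; rewrite mem_Des /=; lia.
by apply: sorted_filter; [exact: ltn_trans | exact: iota_ltn_sorted].
Qed.

Lemma Des_nth_ltn (s : 'S_n) k : k < size (Des s) ->
  nth 0 (0 :: Des s) k < nth 0 (0 :: Des s) k.+1.
Proof.
move=> ks; apply: (sorted_ltn_nth ltn_trans 0 (sorted_Des s)) => //=; rewrite inE /=; lia.
Qed.

Lemma Des_nth_leq (s : 'S_n) k : nth 0 (0 :: Des s) k <= n.
Proof.
case: (ltnP k (size (0 :: Des s))) => [/(mem_nth 0)|/(nth_default 0) -> //].
by rewrite inE mem_Des => /orP[/eqP->|/andP[/andP[]]].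
Qed.

Lemma Des_nth_last (s : 'S_n) : nth 0 (0 :: Des s) (size (Des s)) = n.
Proof.
have nD : n \in 0 :: Des s by rewrite inE mem_Des eqxx n0 leqnn orbT.
have nS := nD; rewrite -index_mem in nS.
apply/eqP; rewrite eqn_leq Des_nth_leq -{1}(nth_index 0 nD).
move: nS; rewrite /= ltnS leq_eqVlt => /orP[/eqP-> //|nS].
apply: ltnW; apply: (sorted_ltn_nth ltn_trans 0 (sorted_Des s)) => //=; rewrite inE /=; lia.
Qed.

Hypothesis eq_size : size (Des pi) = size (iDes pi).

Let I := nth 0 (0 :: Des pi).
Let J := nth 0 (0 :: iDes pi).
Let m := size (Des pi).

(** Blocks are written by decreasing index, so these are the prefixes of [rho pi]
    made of whole blocks. *)
Definition rho_from k := flatten [seq rho_block pi l | l <- rev (iota k (m - k))].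

Lemma rho_from_cat k : k < m -> rho_from k =
  rho_from k.+1 ++ (nseq (I k.+1 - I k) 0 ++ nseq (J k.+1 - J k) 1).
Proof.
move=> km; rewrite /rho_from (_ : m - k = (m - k.+1).+1); last by lia.
by rewrite /= rev_cons map_rcons -cats1 flatten_cat /= cats0.
Qed.

(** The default [1] covers the empty word, to which a first block is appended
    without creating a factor 10. *)
Lemma rho_from_last k : last 1 (rho_from k) = 1.
Proof.
case: (ltnP k m) => [km|]; last first.
  by rewrite /rho_from -subn_eq0 => /eqP->.
rewrite rho_from_cat // !last_cat.
have := @Des_nth_ltn (pi^-1)%g k; rewrite -/(iDes pi) -eq_size => /(_ km) /=.
rewrite -/(J k.+1) -/(J k) -subn_gt0; case: (J k.+1 - J k) => // b _ /=.
by elim: b.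
Qed.

Lemma size_rho_from k : k <= m -> size (rho_from k) = (n - I k) + (n - J k).
Proof.
elim: {k}(m - k) {-2}k (erefl (m - k)) => [|d IH] k kd km.
  have -> : k = m by lia.
  rewrite /rho_from subnn /= /I Des_nth_last.
  by rewrite {1}/m eq_size /J Des_nth_last !subnn.
have km' : k < m by lia.
rewrite rho_from_cat // size_cat IH; [|lia|lia].
rewrite size_cat !size_nseq.
have ltI := Des_nth_ltn km'; have leI := Des_nth_leq pi k.+1.
have ltJ : J k < J k.+1 by apply: Des_nth_ltn; rewrite -[Des _]/(iDes pi) -eq_size.
have leJ := Des_nth_leq (pi^-1)%g k.+1.
rewrite -/(I k) -/(I k.+1) in ltI leI; rewrite -/(iDes pi) -/(J k.+1) in leJ.
lia.
Qed.

(** A factor 10 occurs in [rho pi] exactly where one block meets the next, so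
    the major index adds up the lengths of the proper prefixes made of whole
    blocks. *)
Lemma maj_rho : maj_word (rho pi) =
  \sum_(i <- Des pi) (n - i) + \sum_(j <- iDes pi) (n - j).
Proof.
have maj_from k : k <= m ->
    maj_word (rho_from k) = \sum_(k <= l < m) ((n - I l.+1) + (n - J l.+1)).
  elim: {k}(m - k) {-2}k (erefl (m - k)) => [|d IH] k kd km.
    rewrite /rho_from kd /= big_geq; last by lia.
    by rewrite /maj_word big_geq.
  have km' : k < m by lia.
  rewrite big_ltn // -IH; [|lia|lia].
  rewrite rho_from_cat // maj_word_cat_block ?rho_from_last ?size_rho_from //.
  - by rewrite addnC.
  - by rewrite subn_gt0 Des_nth_ltn.
  - by rewrite subn_gt0 Des_nth_ltn // -[Des _]/(iDes pi) -eq_size.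
have -> : rho pi = rho_from 0 by rewrite /rho_from subn0.
rewrite maj_from // big_split /=; congr addn.
  by rewrite [RHS](big_nth 0).
by rewrite [RHS](big_nth 0) -eq_size.
Qed.
End Rho.
End Words.

(** * Descents of a 231-avoiding permutation and of its inverse *)

Section PeakWord.
Local Open Scope nat_scope.
Context (n : nat).

Lemma oneline_nth (s : 'S_n) (i : 'I_n) : nth 0 (oneline s) i = (s i).+1.
Proof. by rewrite (nth_map i) ?size_enum_ord // nth_ord_enum. Qed.

Context (pi : 'S_n).

(** The row where the label found below peak [b] starts. The labels are read at the
    peaks from right to left, and anchor boxes are labeled from the top while rows
    are counted from the bottom, whence the two reversals. *)
Definition peak_word b := n - nth 0 (oneline pi) (n.-1 - b).

Lemma peak_wordE (b : 'I_n) : peak_word b = n.-1 - pi (rev_ord b).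
Proof.
rewrite /peak_word.
have -> : n.-1 - b = rev_ord b by rewrite /=; lia.
by rewrite oneline_nth; have := ltn_ord b; lia.
Qed.

Lemma peak_word_rev (b : nat) (o : 'I_n) : b + o = n.-1 -> peak_word b = n.-1 - pi o.
Proof.
move=> bo; have bn : b < n by have := ltn_ord o; lia.
rewrite -[b]/(nat_of_ord (Ordinal bn)) peak_wordE; congr (_ - nat_of_ord (pi _)).
by apply: val_inj => /=; lia.
Qed.

Lemma peak_word_lt b : b < n -> peak_word b < n.
Proof. by move=> bn; rewrite (peak_wordE (Ordinal bn)); lia. Qed.

Lemma peak_word_inj b b' : b < n -> b' < n -> peak_word b = peak_word b' -> b = b'.
Proof.
move=> bn b'n; rewrite (peak_wordE (Ordinal bn)) (peak_wordE (Ordinal b'n)) => e.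
have : pi (rev_ord (Ordinal bn)) = pi (rev_ord (Ordinal b'n)).
  apply: val_inj => /=; move: e (ltn_ord (pi (rev_ord (Ordinal bn)))).
  by have := ltn_ord (pi (rev_ord (Ordinal b'n))); lia.
by move/perm_inj/rev_ord_inj/(congr1 val).
Qed.

Lemma peak_word_avoid312 : avoids231 pi ->
  forall i j k, i < j -> j < k -> k < n ->
  ~~ (peak_word j < peak_word k < peak_word i).
Proof.
move=> hpi i j k ij jk kn; have jn := ltn_trans jk kn; have in_ := ltn_trans ij jn.
rewrite (peak_wordE (Ordinal in_)) (peak_wordE (Ordinal jn)) (peak_wordE (Ordinal kn)).
have := @hpi (rev_ord (Ordinal kn)) (rev_ord (Ordinal jn)) (rev_ord (Ordinal in_)).
move: (pi _) (pi _) (pi _) => x y z /=; move: (ltn_ord x) (ltn_ord y) (ltn_ord z).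
by move=> xn yn zn av; have := av _ _; lia.
Qed.

End PeakWord.

Section DescentTops.
Local Open Scope nat_scope.
Context (n : nat).

Definition proper_Des (s : 'S_n) := [seq i <- Des s | i < n].

Lemma proper_DesP (s : 'S_n) (P : nat) :
  reflect (exists o p : 'I_n, [/\ p = o.+1 :> nat, P = p & s p < s o])
          (P \in proper_Des s).
Proof.
rewrite mem_filter mem_Des; apply: (iffP idP).
  case/andP=> Pn /andP[/andP[P0 _]]; rewrite (ltn_eqF Pn) /=.
  have on : P.-1 < n by lia.
  rewrite (oneline_nth s (Ordinal Pn)) (oneline_nth s (Ordinal on)) => d.
  by exists (Ordinal on), (Ordinal Pn); split => //=; rewrite prednK.
case=> o [p [po -> d]]; rewrite ltn_ord po /= -po ltnW // oneline_nth oneline_nth.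
by rewrite ltnS d orbT.
Qed.

Hypothesis n0 : 0 < n.

Lemma perm_Des (s : 'S_n) : perm_eq (Des s) (n :: proper_Des s).
Proof.
apply: uniq_perm => [||/= i].
- by apply: filter_uniq; apply: iota_uniq.
- rewrite /= mem_filter ltnn /=; apply: filter_uniq; apply: filter_uniq.
  exact: iota_uniq.
rewrite inE [X in _ || X]mem_filter mem_Des; case: eqP => [->|ni]; first by rewrite n0 leqnn.
by rewrite /=; lia.
Qed.

Context (pi : 'S_n).
Hypothesis hpi : avoids231 pi.

(** Values are counted from 0 here. If [v] is a descent of the inverse, then [v]
    stands left of [v - 1], and the entry right after [v] must be smaller than
    [v], as a larger one would make a pattern 231 with [v] and [v - 1].
    Conversely, let [v] be the top of a descent; if [v - 1] stood left of [v],
    then [v - 1], [v] and the bottom of the descent would form a pattern 231. *)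
Lemma mem_iDes_tops v : (v \in proper_Des (pi^-1)%g) =
  (v \in [seq (nth 0 (oneline pi) P.-1).-1 | P <- proper_Des pi]).
Proof.
apply/idP/mapP => [/proper_DesP[v' [v1 [vv -> lt]]]|].
  set o := (pi^-1)%g v1 in lt; set q := (pi^-1)%g v' in lt.
  have eo : pi o = v1 by rewrite permKV.
  have eq : pi q = v' by rewrite permKV.
  have pn : o.+1 < n by exact: leq_ltn_trans lt (ltn_ord q).
  exists o.+1; last by rewrite /= oneline_nth eo.
  apply/proper_DesP; exists o, (Ordinal pn); split=> //.
  have [//|gt|] := ltngtP (pi (Ordinal pn)) (pi o); last first.
    by move=> /val_inj/perm_inj /(congr1 val) /=; lia.
  have [e|ne] := eqVneq (Ordinal pn) q; first by move: gt; rewrite e eo eq; lia.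
  have pq : Ordinal pn < q.
    rewrite ltn_neqAle lt andbT; by apply: contraNneq ne => e; apply/eqP/val_inj.
  by have := hpi (ltnSn o : o < Ordinal pn) pq; rewrite gt eo eq vv ltnS leqnn.
move=> [P /proper_DesP[o [p [po -> lt]]] ->].
rewrite po /= oneline_nth /=; apply/proper_DesP.
have v'n : (pi o).-1 < n by have := ltn_ord (pi o); lia.
exists (Ordinal v'n), (pi o); split=> //=; first by lia.
rewrite permK; set q := (pi^-1)%g _.
have eq : pi q = (pi o).-1 :> nat by rewrite permKV.
have [//|qo|/val_inj e] := ltngtP o q; last by move: eq; rewrite -e; lia.
have op : o < p by rewrite po.
have := hpi qo op; rewrite eq => /negP[].
have : pi p != pi q :> nat.
  by apply/eqP => /val_inj/perm_inj e; move: qo; rewrite -e; lia.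
by rewrite eq; lia.
Qed.

Lemma perm_iDes_tops : perm_eq (proper_Des (pi^-1)%g)
  [seq (nth 0 (oneline pi) P.-1).-1 | P <- proper_Des pi].
Proof.
have uD (s : 'S_n) : uniq (proper_Des s).
  by do 2!apply: filter_uniq; exact: iota_uniq.
apply: uniq_perm (mem_iDes_tops) => //; rewrite map_inj_in_uniq //.
move=> P P' /proper_DesP[o [p [po -> _]]] /proper_DesP[o' [p' [po' -> _]]].
by rewrite po po' /= !oneline_nth /= => /val_inj/perm_inj->.
Qed.

Definition peak_descents := [seq e <- iota 1 n.-1 | peak_word pi e < peak_word pi e.-1].

Lemma perm_peak_descents :
  perm_eq (proper_Des pi) [seq n - e | e <- peak_descents].
Proof.
apply: uniq_perm.
- by do 2!apply: filter_uniq; exact: iota_uniq.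
- rewrite map_inj_in_uniq; first by apply: filter_uniq; exact: iota_uniq.
  by move=> e e'; rewrite !mem_filter !mem_iota; lia.
move=> P; apply/proper_DesP/mapP.
  move=> [o [p [po -> lt]]]; have pn := ltn_ord p.
  exists (n - p); last by lia.
  rewrite mem_filter mem_iota (@peak_word_rev _ _ _ o) ?(@peak_word_rev _ _ _ p); try lia.
  by have := ltn_ord (pi o); lia.
move=> [e]; rewrite mem_filter mem_iota => /andP[lt en] ->.
have on : n.-1 - e < n by lia.
have pn : n - e < n by lia.
exists (Ordinal on), (Ordinal pn); split=> //=; first by lia.
move: lt; rewrite (@peak_word_rev _ _ e (Ordinal on)) /=; last by lia.
rewrite (@peak_word_rev _ _ e.-1 (Ordinal pn)) /=; last by lia.
by have := ltn_ord (pi (Ordinal on)); have := ltn_ord (pi (Ordinal pn)); lia.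
Qed.

Lemma maj_rho_peaks :
  maj_word (rho pi) = \sum_(e <- peak_descents) (e + peak_word pi e + 1).
Proof.
have szD : size (Des pi) = size (iDes pi).
  rewrite (perm_size (perm_Des pi)) (perm_size (perm_Des (pi^-1)%g)) /=.
  by rewrite (perm_size perm_iDes_tops) size_map.
rewrite maj_rho // (perm_big _ (perm_Des pi)) (perm_big _ (perm_Des (pi^-1)%g)) /=.
rewrite !big_cons subnn !add0n (perm_big _ perm_iDes_tops) /= big_map -big_split /=.
rewrite (perm_big _ perm_peak_descents) /= big_map.
rewrite big_seq [RHS]big_seq; apply: eq_bigr => e.
rewrite mem_filter mem_iota => /andP[_ en].
have on : n.-1 - e < n by lia.
rewrite (@peak_word_rev _ _ e (Ordinal on)) /=; last by lia.
rewrite (_ : (n - e).-1 = Ordinal on); last by rewrite /=; lia.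
by rewrite oneline_nth; have := ltn_ord (pi (Ordinal on)); lia.
Qed.

End DescentTops.

(** * Lehmer codes of 312-avoiding words *)

Section Lehmer.
Local Open Scope nat_scope.
Context (n : nat) (w : nat -> nat).
Hypothesis w_lt : forall b, b < n -> w b < n.
Hypothesis w_inj : forall b b', b < n -> b' < n -> w b = w b' -> b = b'.

(** The threshold [r] is free because a trajectory starting in row [r] is
    followed past nodes [b] with [w b] different from [r]. *)
Definition lower_from b r := count (fun b' => w b' < r) (iota b (n - b)).

Definition code b := lower_from b (w b).

Lemma lower_fromS b r : b < n -> lower_from b r = (w b < r) + lower_from b.+1 r.
Proof. by move=> bn; rewrite /lower_from (_ : n - b = (n - b.+1).+1) //; lia. Qed.

Lemma lower_from0 r : r <= n -> lower_from 0 r = r.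
Proof.
move=> rn; rewrite /lower_from subn0.
have pw : perm_eq [seq w b | b <- iota 0 n] (iota 0 n).
  have uw : uniq [seq w b | b <- iota 0 n].
    rewrite map_inj_in_uniq ?iota_uniq // => b b'.
    by rewrite !mem_iota /= !add0n; apply: w_inj.
  have sw : {subset [seq w b | b <- iota 0 n] <= iota 0 n}.
    move=> v /mapP[b]; rewrite !mem_iota /= !add0n => bn ->; exact: w_lt.
  have sz : size (iota 0 n) <= size [seq w b | b <- iota 0 n].
    by rewrite size_map.
  by apply: uniq_perm; rewrite ?iota_uniq //; case: (uniq_min_size uw sw sz).
rewrite -(count_map w (fun v => v < r)) (seq.permP pw).
rewrite -[n](subnKC rn) iotaD count_cat add0n.
rewrite (eq_in_count (a2 := predT)) ?count_predT ?size_iota; last first.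
  by move=> v; rewrite mem_iota /=; lia.
rewrite (eq_in_count (a2 := pred0)) ?count_pred0 ?addn0 //.
by move=> v; rewrite mem_iota /=; lia.
Qed.

Lemma code_lt b r : b < n -> w b < r -> code b < lower_from b r.
Proof.
move=> bn lt; rewrite /code !(lower_fromS _ bn) ltnn lt add0n add1n ltnS.
by apply: sub_count => x /= /ltn_trans; apply.
Qed.

Lemma lower_from_anti b b' r : b <= b' -> b' <= n -> lower_from b' r <= lower_from b r.
Proof.
move=> bb' b'n; rewrite /lower_from (_ : n - b = (b' - b) + (n - b')); last by lia.
by rewrite iotaD count_cat subnKC // leq_addl.
Qed.

Lemma lower_from_leq b r r' : r <= r' -> lower_from b r <= lower_from b r'.
Proof. by move=> rr'; apply: sub_count => x /= h; exact: leq_trans h rr'. Qed.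

(** The row in which the trajectory starting in row [r] passes node [b], when [h]
    gives the heights of the tiling. The trajectory stops at the first [b] where
    [h b] is this row; beyond it the value has no geometric meaning. *)
Fixpoint level (h : nat -> nat) r b :=
  if b is b'.+1 then level h r b' - (h b' < level h r b') else r.

(** Decoding a Lehmer code: at node [b] the trajectory starting in row [w k] has as
    many trajectories below it as there are smaller rows still to be placed. The
    one that stops at [b] has [h b] below it, so those above it drop and those
    below it do not. *)
Lemma code_of_trajectories (h : nat -> nat) :
  (forall k, k < n -> h k = level h (w k) k) -> forall k, k < n -> h k = code k.
Proof.
move=> hk; have lev k b : k < n -> b <= k -> level h (w k) b = lower_from b (w k).
  elim: b k => [|b IH] k kn bk; first by rewrite lower_from0 // ltnW // w_lt.
  have bn : b < n by lia.
  rewrite /= IH //; last by lia.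
  have -> : h b = code b by rewrite hk // IH.
  have -> : (code b < lower_from b (w k)) = (w b < w k).
    have [lt|gt|e] := ltngtP (w b) (w k); first by rewrite code_lt.
      by apply/negbTE; rewrite -leqNgt lower_from_leq // ltnW.
    by have := w_inj bn kn e; lia.
  by rewrite lower_fromS //; lia.
by move=> k kn; rewrite hk // lev.
Qed.

Hypothesis avoid312 : forall i j k, i < j -> j < k -> k < n -> ~~ (w j < w k < w i).

Lemma code_ascent b : b.+1 < n -> w b < w b.+1 -> code b <= code b.+1.
Proof.
move=> bn lt; rewrite /code (lower_fromS _ (ltnW bn)) ltnn add0n.
by rewrite lower_from_leq // ltnW.
Qed.

(** A later letter between [w b.+1] and [w b] would form a pattern 312 with them. *)
Lemma code_descent b : b.+1 < n -> w b.+1 < w b -> code b = (code b.+1).+1.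
Proof.
move=> bn lt; rewrite /code (lower_fromS _ (ltnW bn)) ltnn add0n.
rewrite !(lower_fromS _ bn) lt ltnn add0n add1n; congr _.+1.
apply: eq_in_count => k; rewrite mem_iota => kb.
have := @avoid312 b b.+1 k (ltnSn b) _ _; have := @w_inj k b.+1 _ bn; lia.
Qed.

(** Over a maximal run of codes above [code e] ending just before [e], the letters
    exceed [w e], and the letters left of the run are smaller; so the number [w e]
    of letters smaller than [w e] is [a] plus [code e]. *)
Lemma word_of_run a e : a <= e -> e < n ->
  (forall x, a <= x < e -> code e < code x) ->
  (0 < a -> code a.-1 <= code e) -> w e = a + code e.
Proof.
move=> ae en run stop.
(* The last letter of the run below [w e] would have a code at most [code e]. *)
have big d x : x + d = e -> a <= x -> w e <= w x.
  elim/ltn_ind: d x => d IH x xd ax.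
  rewrite leqNgt; apply/negP => lt; have [e0|xe] := eqVneq x e.
    by move: lt; rewrite e0 ltnn.
  have := run x; rewrite [_ && _](_ : _ = true); last by lia.
  move=> /(_ isT); rewrite ltnNge /code.
  rewrite /lower_from (_ : n - x = d + (n - e)); last by lia.
  rewrite iotaD xd count_cat.
  rewrite (eq_in_count (a2 := pred0)) ?count_pred0.
    by move=> /negP; apply; exact: (@lower_from_leq e _ _ (ltnW lt)).
  move=> y; rewrite mem_iota => yx /=; apply/negbTE; rewrite -leqNgt.
  have [-> //|ne] := eqVneq y x.
  apply: leq_trans (ltnW lt) (IH (e - y) _ y _ _); lia.
(* A letter before [a.-1] exceeding [w e] would form a pattern 312 with [a.-1]
   and [e]. *)
have small x : x < a -> w x < w e.
  have sa : 0 < a -> w a.-1 < w e.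
    move=> a0; rewrite ltnNge; apply/negP => le.
    have lt : w e < w a.-1.
      by rewrite ltn_neqAle le andbT; apply/eqP => /w_inj; lia.
    have := stop a0; rewrite leqNgt => /negP[].
    apply: leq_trans (code_lt en lt) _; apply: lower_from_anti; lia.
  move=> xa; have a0 : 0 < a by exact: leq_ltn_trans xa.
  have [->|ne] := eqVneq x a.-1; first exact: sa.
  have := @avoid312 x a.-1 e; have := sa a0; have := @w_inj x e; lia.
rewrite -[LHS](@lower_from0 (w e)); last by exact: ltnW (w_lt en).
rewrite /lower_from subn0 (_ : n = a + ((e - a) + (n - e))); last by lia.
rewrite !iotaD !count_cat add0n subnKC //.
rewrite (eq_in_count (a2 := predT)) ?count_predT ?size_iota; last first.
  by move=> x; rewrite mem_iota => xa; rewrite /= small.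
rewrite (eq_in_count (a2 := pred0)) ?count_pred0 ?add0n //.
move=> x; rewrite mem_iota => xa /=; apply/negbTE; rewrite -leqNgt.
by apply: (big (e - x)); lia.
Qed.
End Lehmer.

(** * Rows of squares *)

Section Rows.

(** Row [j]: the lower boundary raised by [2 * j + 1], seen as a path of centers. *)
Definition row_square (j x : nat) : square := (x%:Z, (j.*2 + 1 + odd x)%:Z).

Lemma row_square_eq j x j' x' :
  (row_square j x == row_square j' x') = (j == j')%N && (x == x')%N.
Proof.
apply/eqP/andP => [[ex ey]|[/eqP-> /eqP->] //].
have xx : x = x' by lia.
by move: ey; rewrite xx; split; apply/eqP => //; lia.
Qed.

Lemma region_row n j x : region n (row_square j x) = (x + j.*2 + odd x < n.*2)%N.
Proof. rewrite /region /=; lia. Qed.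

Lemma region_in_row n s : region n s -> exists j x, s = row_square j x.
Proof.
case: s => x y; rewrite /region /= => /and4P[x0 y1 /eqP xy _].
exists `|((y - 1) %/ 2)%Z|%N, `|x|%N; rewrite /row_square; congr pair; lia.
Qed.

(** From node [a] to node [e], the node [b] having abscissa [2 * b]. *)
Definition row_run j a e : tile :=
  [seq row_square j x | x <- iota a.*2 (e - a).*2.+1].

Lemma mem_row_run j a e j' x :
  (row_square j' x \in row_run j a e) = (j' == j) && (a.*2 <= x <= a.*2 + (e - a).*2)%N.
Proof.
apply/mapP/idP => [[x']|/andP[/eqP-> xae]].
  rewrite mem_iota => xae /eqP; rewrite row_square_eq => /andP[/eqP-> /eqP->].
  by rewrite eqxx; lia.
by exists x => //; rewrite mem_iota; lia.
Qed.

Lemma size_row_run j a e : size (row_run j a e) = (e - a).*2.+1.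
Proof. by rewrite size_map size_iota. Qed.

Lemma leftmost_row_run j a e : leftmost (row_run j a e) = row_square j a.*2.
Proof. by []. Qed.

Lemma rightmost_row_run j a e : (a <= e)%N ->
  rightmost (row_run j a e) = row_square j e.*2.
Proof.
move=> ae; rewrite /rightmost -nth_last size_row_run (nth_map 0%N) ?size_iota //.
by rewrite nth_iota //; congr row_square; lia.
Qed.

Definition in_row j (d : tile) := forall s, s \in d -> exists x, s = row_square j x.

Lemma dyck_path_in_row j x d : path dyck_step (row_square j x) d -> in_row j d ->
  d = [seq row_square j y | y <- iota x.+1 (size d)].
Proof.
elim: d x => [//|s d IH] x /= /andP[st pd] rd.
have [y sy] := rd s (mem_head _ _).
have yx : y = x.+1 by move: st; rewrite sy /dyck_step /=; lia.
rewrite -yx -sy -IH //; first by rewrite -sy.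
by move=> t td; apply: rd; rewrite inE td orbT.
Qed.

(** A Dyck tile inside one row cannot start at an odd abscissa, as its next
    square would be lower; and it ends at the height where it starts. *)
Lemma dyck_tile_in_row j d : is_dyck_tile d -> in_row j d ->
  (exists a e, (a <= e)%N /\ d = row_run j a e) \/ (exists x, d = [:: row_square j x.*2.+1]).
Proof.
case: d => [//|s d] /and3P[pd ld ad] rd.
have [x sx] := rd s (mem_head _ _).
have /dyck_path_in_row : path dyck_step (row_square j x) d by rewrite -sx.
move=> /(_ (fun t td => rd t (@mem_behead _ (s :: d) t td))) ed.
case: d pd ld ad rd ed => [|t d] pd ld ad rd ed.
  have [ox|ex] := boolP (odd x).
    by right; exists x./2; rewrite sx; congr [:: row_square _ _]; lia.
  left; exists x./2, x./2; split=> //; rewrite sx /row_run subnn /=.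
  by congr [:: row_square _ _]; lia.
left.
have ex : ~~ odd x.
  by move: ad; case: ed => -> _; rewrite sx /= => /andP[+ _]; lia.
have eN : ~~ odd (size (t :: d)).
  move: ld; rewrite ed sx -nth_last size_map size_iota (nth_map 0%N) ?size_iota //.
  by rewrite nth_iota //=; lia.
exists x./2, ((x + size (t :: d))./2)%N; split; first by rewrite /=; lia.
rewrite sx ed size_map size_iota /row_run.
rewrite (_ : (x./2).*2 = x); last by lia.
rewrite (_ : (_ - _).*2 = size (t :: d)); last by move: eN; lia.
by [].
Qed.

End Rows.

(** * Dyck tilings as sequences of heights *)

Section Tiling.
Local Open Scope nat_scope.
Context (n : nat) (D : {fset tile}).
Hypothesis hD : dyck_tiling n D.

Lemma tile_region d s : d \in D -> s \in d -> region n s.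
Proof. by case: hD => _ R _ _ dD sd; apply/R; exists d. Qed.

Lemma tile_eq d d' s : d \in D -> d' \in D -> s \in d -> s \in d' -> d = d'.
Proof. by case: hD => _ _ U _ dD d'D; apply: U. Qed.

(** Cover-inclusivity makes the translate of a tile a piece of the tile two units
    below, and hence, level by level, a piece of the lower boundary. *)
Lemma tile_in_row d : d \in D -> exists j, in_row j d.
Proof.
have [tileD _ _ incl] := hD.
have low e s : e \in D -> s \in e -> ((leftmost e).2 <= s.2)%R.
  move=> /tileD; case: e => [//|t e] /and3P[_ _ ale].
  by rewrite inE => /orP[/eqP-> //|/(allP ale)].
move=> dD; have [k kd] : exists k : nat, ((leftmost d).2 <= k%:Z)%R.
  by exists `|(leftmost d).2|; lia.
elim: k d dD kd => [|k IH] d dD kd.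
  have hd : leftmost d \in d by move/tileD: dD; case: (d) => // s d' _; rewrite mem_head.
  by have := tile_region dD hd; rewrite /region; lia.
have [[d' [d'D _ sub]]|below] := incl _ dD; last first.
  exists 0 => s sd; have [j [x ex]] := region_in_row (tile_region dD sd).
  have := allP below _ (map_f down2 sd).
  rewrite ex /below_lambda_b /down2 /= => bel; exists x; congr row_square; lia.
have hd : leftmost d \in d by move/tileD: dD; case: (d) => // s d'' _; rewrite mem_head.
have := low _ _ d'D (sub _ (map_f down2 hd)); rewrite /down2 /= => kd'.
have [j rj] : exists j, in_row j d' by apply: IH => //; lia.
exists j.+1 => s sd; have [x] := rj _ (sub _ (map_f down2 sd)).
by case: s {sd} => u v [-> ev]; exists x; rewrite /row_square; congr pair; lia.
Qed.

Lemma tile_shape d : d \in D ->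
  (exists j a e, a <= e /\ d = row_run j a e) \/ (exists j x, d = [:: row_square j x.*2.+1]).
Proof.
move=> dD; have [j rj] := tile_in_row dD.
have [tileD _ _ _] := hD.
have [[a [e [ae de]]]|[x dx]] := dyck_tile_in_row (tileD _ dD) rj.
  by left; exists j, a, e.
by right; exists j, x.
Qed.

(** The square between the nodes [b] and [b.+1] is higher than both, so a nontrivial
    tile containing it cannot start or end there and contains both nodes. *)
Definition merged j b := has (fun d => (row_square j b.*2.+1 \in d) && (1 < size d)) D.

Lemma mergedP j b :
  reflect (exists a e, [/\ row_run j a e \in D, a <= b & b < e]) (merged j b).
Proof.
apply: (iffP hasP) => [[d dD /andP[sd d1]]|[a [e [dD ab be]]]].
  have [[j' [a [e [ae de]]]]|[j' [x dx]]] := tile_shape dD; last by rewrite dx in d1.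
  move: sd; rewrite de mem_row_run => /andP[/eqP-> xae].
  by exists a, e; rewrite -de; split=> //; lia.
exists (row_run j a e) => //; rewrite mem_row_run size_row_run eqxx /=; lia.
Qed.

Lemma merged_lt j b : merged j b -> j < n.
Proof.
case/mergedP=> a [e [dD ab be]].
have : row_square j a.*2 \in row_run j a e by rewrite mem_row_run eqxx /=; lia.
by move/(tile_region dD); rewrite region_row; lia.
Qed.

Lemma row_run_lt j a e : row_run j a e \in D -> a <= e -> e < n.
Proof.
move=> dD ae; have : row_square j e.*2 \in row_run j a e by rewrite mem_row_run eqxx /=; lia.
by move/(tile_region dD); rewrite region_row; lia.
Qed.

(** Otherwise the tile merging node [e] with the next one would overlap this one. *)
Lemma merged_right j a e : row_run j a e \in D -> a <= e -> ~~ merged j e.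
Proof.
move=> dD ae; apply/mergedP => -[a' [e' [d'D a'e ee']]].
have s1 : row_square j e.*2 \in row_run j a e by rewrite mem_row_run eqxx /=; lia.
have s2 : row_square j e.*2 \in row_run j a' e' by rewrite mem_row_run eqxx /=; lia.
have : row_square j e.*2.+1 \in row_run j a' e' by rewrite mem_row_run eqxx /=; lia.
by rewrite -(tile_eq dD d'D s1 s2) mem_row_run eqxx /=; lia.
Qed.

Lemma merged_left j a e : row_run j a e \in D -> a <= e -> 0 < a -> ~~ merged j a.-1.
Proof.
move=> dD ae a0; apply/mergedP => -[a' [e' [d'D a'e ee']]].
have s1 : row_square j a.*2 \in row_run j a e by rewrite mem_row_run eqxx /=; lia.
have s2 : row_square j a.*2 \in row_run j a' e' by rewrite mem_row_run eqxx /=; lia.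
have : row_square j a.-1.*2 \in row_run j a' e' by rewrite mem_row_run eqxx /=; lia.
by rewrite -(tile_eq dD d'D s1 s2) mem_row_run eqxx /=; lia.
Qed.

(** Cover-inclusivity, applied to node [b] and the square after it. *)
Lemma merged_down j b : merged j.+1 b -> merged j b.
Proof.
case/mergedP=> a [e [dD ab be]].
have [_ _ _ incl] := hD.
have in_run x : a.*2 <= x <= a.*2 + (e - a).*2 -> row_square j.+1 x \in row_run j.+1 a e.
  by rewrite mem_row_run eqxx.
have [[d' [d'D _ sub]]|/allP below] := incl _ dD; last first.
  have /(map_f down2)/below := in_run b.*2.+1 ltac:(lia).
  by rewrite /below_lambda_b /=; lia.
have down x : down2 (row_square j.+1 x) = row_square j x.
  by rewrite /down2 /row_square /=; congr pair; lia.
have /(map_f down2)/sub := in_run b.*2.+1 ltac:(lia).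
have /(map_f down2)/sub := in_run b.*2 ltac:(lia).
rewrite !down => s1 s2; apply/hasP; exists d' => //; rewrite s2 /=.
case: d' s1 s2 {d'D sub} => [|s [|t d']] //; rewrite !inE => /eqP<-.
by rewrite row_square_eq; lia.
Qed.

(** The rows where [b] and [b.+1] are merged are the lowest ones, so the first
    other row is also their number. *)
Definition height b := find (fun j => ~~ merged j b) (iota 0 n).

Lemma mergedE j b : merged j b = (j < height b).
Proof.
apply/idP/idP => [mj|jh]; last first.
  have := before_find 0 jh; rewrite nth_iota ?add0n; first by move/negbFE.
  by apply: leq_trans jh _; rewrite -[leqRHS](size_iota 0) find_size.
have jn := merged_lt mj; rewrite ltnNge; apply/negP => hj.
have mh : merged (height b) b.
  have -> : height b = j - (j - height b) by lia.
  elim: (j - height b) => [|k IH]; first by rewrite subn0.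
  have [jk|jk] := leqP j k; first by rewrite (_ : j - k.+1 = j - k) //; lia.
  by apply: merged_down; rewrite -subSn.
have hn : height b < n by exact: leq_ltn_trans hj jn.
have := @nth_find _ 0 (fun j => ~~ merged j b) (iota 0 n).
rewrite -/(height b) nth_iota // add0n mh => /(_ _) /=.
by rewrite has_find -/(height b) size_iota hn => /(_ isT).
Qed.

End Tiling.

(** * Trajectories and nontrivial tiles *)

Section Trajectories.
Local Open Scope nat_scope.
Context (n : nat) (D : {fset tile}).
Hypothesis hD : dyck_tiling n D.

Let h := height n D.

(** What holds of a tile [d] entered by the trajectory starting in row [r]: its row
    is the one predicted by [level]. A trajectory alternates between tiles starting
    at a node and single squares between two nodes. *)
Definition trajectory_at r d :=
  (exists j a e, [/\ a <= e, d = row_run j a e & level h r a = j])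
  \/ (exists j b, d = [:: row_square j b.*2.+1] /\ level h r b.+1 = j).

Lemma level_run r j a e : row_run j a e \in D -> a <= e -> level h r a = j -> level h r e = j.
Proof.
move=> dD ae la; have [m em] : exists m, e = a + m by exists (e - a); lia.
have : m <= e - a by lia.
rewrite {2}em; elim: m {em} => [|m IH] me; first by rewrite addn0.
rewrite addnS /= IH; last by lia.
have : merged D j (a + m) by apply/(mergedP hD); exists a, e; split=> //; lia.
by rewrite (mergedE hD) -/h; lia.
Qed.

Lemma exit_row_run j a e : a <= e -> exit (row_run j a e) = ((e.*2)%:Z, (j.*2)%:Z).
Proof.
by move=> ae; rewrite /exit /se_edge rightmost_row_run //=; congr pair; lia.
Qed.

(** The square after the exit of a tile of row [j] ending at node [e] lies between
    the nodes [e] and [e.+1] of row [j.-1], or outside the region if [j] is 0. If it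
    is inside a nontrivial tile or outside the region, the trajectory stops and
    [h e = j]. Otherwise it is a tile by itself, through which the trajectory drops
    to row [j.-1]. *)
Lemma trajectory_level r d ds (k : 'I_n) : d \in D -> trajectory_at r d ->
  path (follows D) d ds -> ends_below D (last d ds) k -> h k = level h r k.
Proof.
elim: ds d => [|d' ds IH] d dD [[j [a [e [ae de la]]]]|[j [b [db lb]]]].
- move=> _ /=; rewrite de in dD *.
  have le := level_run dD ae la; have me := merged_right hD dD ae.
  rewrite (mergedE hD) -/h -leqNgt in me.
  rewrite /ends_below exit_row_run // => -[[ek j0]|[d' [d'D nd' bd ne /= ek]]].
    have -> : k = e :> nat by lia.
    by rewrite le; lia.
  have -> : k = e :> nat by lia.
  rewrite le; apply/eqP; rewrite eqn_leq me /=.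
  have nin : (row_square j e.*2 \in d') = false.
    have sd : row_square j e.*2 \in row_run j a e by rewrite mem_row_run eqxx /=; lia.
    by apply: contraNF nd' => sd'; apply/eqP; exact: (tile_eq hD d'D dD sd' sd).
  move: bd; rewrite /on_boundary /= (_ : (_, _) = row_square j e.*2); last first.
    by rewrite /row_square; congr pair; lia.
  rewrite nin /= => sd'.
  have := tile_region hD d'D sd'; rewrite /region /= => rs.
  have ej : ((e.*2)%:Z + 1, (j.*2)%:Z)%R = row_square j.-1 e.*2.+1.
    by rewrite /row_square; congr pair; lia.
  rewrite ej in sd'.
  have [j0|jp] := posnP j; first by rewrite j0.
  rewrite -(prednK jp) -(mergedE hD); apply/hasP; exists d' => //; rewrite sd' /=.
  case: d' ne sd' {d'D nd' nin} => [|s [|s' d']] //; rewrite inE => + /eqP es.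
  by rewrite -es /entry /nw_edge /leftmost /= => /eqP[]; congr pair; lia.
- move=> _ /=; rewrite db /ends_below /exit /se_edge /rightmost /= => -[[]|[d' [_ _ _ _]]]; lia.
- move=> /= /andP[/and3P[d'D nd' /eqP ent] pds] end_; apply: (IH d') => //.
  rewrite de in dD ent; rewrite exit_row_run // in ent.
  have le := level_run dD ae la; have me := merged_right hD dD ae.
  right; have [[j' [a' [e' [ae' de']]]]|[j' [b dx]]] := tile_shape hD d'D.
    by move: ent; rewrite de' /entry leftmost_row_run /nw_edge /= => -[]; lia.
  move: ent; rewrite dx /entry /nw_edge /= => -[ex ey].
  have be : b = e by lia.
  have ej : j = j'.+1 by lia.
  exists j', b; split=> //; rewrite be /= le.
  suff: ~~ merged D j' e by rewrite (mergedE hD) -/h; lia.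
  apply/hasPn => t tD; apply/negP => /andP[st t1].
  have sd' : row_square j' e.*2.+1 \in d' by rewrite dx be mem_head.
  by move: t1; rewrite (tile_eq hD tD d'D st sd') dx.
- move=> /= /andP[/and3P[d'D nd' /eqP ent] pds] end_; apply: (IH d') => //.
  left; have [[j' [a' [e' [ae' de']]]]|[j' [x dx]]] := tile_shape hD d'D; last first.
    by move: ent; rewrite dx db /entry /exit /nw_edge /se_edge /= => -[]; lia.
  move: ent; rewrite de' db /entry /exit /nw_edge /se_edge /= => -[ex ey].
  exists j', a', e'; split=> //.
  rewrite (_ : a' = b.+1); last by lia.
  by rewrite lb; lia.
Qed.

Context (pi : 'S_n).
Hypothesis hDpi : tiling_perm D pi.
Let w := peak_word pi.

Lemma height_code b : b < n -> h b = code n w b.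
Proof.
apply: code_of_trajectories.
- exact: peak_word_lt.
- exact: peak_word_inj.
move=> k kn; set o := Ordinal kn.
have := hDpi (rev_ord o); rewrite rev_ordK => -[d [ds [dD ad pd ed]]].
rewrite -[k]/(nat_of_ord o) /w peak_wordE.
apply: (trajectory_level dD _ pd ed); left.
have ea : anchor (pi (rev_ord o)) = row_square (n.-1 - pi (rev_ord o)) 0.
  by have := ltn_ord (pi (rev_ord o)); rewrite /anchor /row_square => ?; congr pair; lia.
have [[j [a [e [ae de]]]]|[j [x dx]]] := tile_shape hD dD; last first.
  by move: ad; rewrite dx ea inE row_square_eq; lia.
move: ad; rewrite de ea mem_row_run => /andP[/eqP ej a0].
by exists j, a, e; split=> //; rewrite (_ : a = 0); last by lia.
Qed.

Hypothesis hpi : avoids231 pi.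

(** Codes exceed [j] along the tile and not at its right end [e], so the code drops
    there, which only happens at a descent; as it drops by one, it falls from
    [j.+1] to [j]. *)
Lemma row_run_spec j a e : row_run j a e \in D -> a < e ->
  [/\ w e < w e.-1, j = h e & w e = a + j].
Proof.
move=> dD ae; have en := row_run_lt hD dD (ltnW ae).
have run x : a <= x < e -> j < h x.
  by move=> xae; rewrite /h -(mergedE hD); apply/(mergedP hD); exists a, e; split=> //; lia.
have := merged_right hD dD (ltnW ae); rewrite (mergedE hD) -/h -leqNgt => he.
have e1 : e.-1.+1 = e by lia.
have desc : w e < w e.-1.
  have [//|lt|e_] := ltngtP (w e) (w e.-1).
    have := @code_ascent n w e.-1; rewrite e1 => /(_ en lt).
    by rewrite -!height_code //; [have := run e.-1 | ]; lia.
  by have := @peak_word_inj _ pi e e.-1 en _ e_; lia.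
have := @code_descent n w (@peak_word_inj _ pi) (peak_word_avoid312 hpi) e.-1.
rewrite e1 => /(_ en desc); rewrite -!height_code //; last by lia.
move=> hd; have ej : j = h e by have := run e.-1; lia.
split=> //; rewrite ej height_code //.
apply: (@word_of_run n w (@peak_word_lt _ pi) (@peak_word_inj _ pi) (peak_word_avoid312 hpi)).
- exact: ltnW.
- by [].
- by move=> x xae; rewrite -!height_code -?ej //; [exact: run | lia].
move=> a0; rewrite -!height_code -?ej //; last by lia.
by have := merged_left hD dD (ltnW ae) a0; rewrite (mergedE hD) -/h -leqNgt.
Qed.

(** The code at [e.-1] is one more than [h e], so the nodes [e.-1] and [e] are
    merged in row [h e], while [e] and [e.+1] are not. *)
Lemma descent_row_run e : e \in peak_descents pi ->
  exists2 a, a < e & row_run (h e) a e \in D.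
Proof.
rewrite mem_filter mem_iota => /andP[desc en].
have e1 : e.-1.+1 = e by lia.
have en' : e < n by lia.
have := @code_descent n w (@peak_word_inj _ pi) (peak_word_avoid312 hpi) e.-1.
rewrite e1 => /(_ en' desc); rewrite -!height_code //; last by lia.
move=> hd; have : merged D (h e) e.-1 by rewrite (mergedE hD) -/h hd.
case/(mergedP hD) => a [e' [dD ae ee']].
have [ee|ne] := eqVneq e' e; first by rewrite ee in dD; exists a => //; lia.
have : merged D (h e) e by apply/(mergedP hD); exists a, e'; split=> //; lia.
by rewrite (mergedE hD) -/h ltnn.
Qed.

(** The left end is [w e - h e] because [w e = a + h e] in [row_run_spec]. *)
Definition descent_tile e := row_run (h e) (w e - h e) e.

Lemma nontrivial_tiles :
  perm_eq [seq d <- D | size d != 1] [seq descent_tile e | e <- peak_descents pi].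
Proof.
have tileP j a e : row_run j a e \in D -> a < e -> row_run j a e = descent_tile e.
  by move=> dD ae; have [_ ej ew] := row_run_spec dD ae; rewrite /descent_tile ew -ej addnK.
apply: uniq_perm.
- exact/filter_uniq/fset_uniq.
- rewrite map_inj_in_uniq; first by apply: filter_uniq; exact: iota_uniq.
  move=> e e' /descent_row_run[a ae dD] /descent_row_run[a' ae' d'D].
  rewrite -(tileP _ _ _ dD ae) -(tileP _ _ _ d'D ae') => /(congr1 rightmost).
  rewrite (rightmost_row_run _ (ltnW ae)) (rightmost_row_run _ (ltnW ae')).
  by move/eqP; rewrite row_square_eq => /andP[_ /eqP]; lia.
move=> d; rewrite mem_filter; apply/andP/mapP => [[d1 dD]|[e /descent_row_run[a ae dD] ->]].
  have [[j [a [e [ae de]]]]|[j [x dx]]] := tile_shape hD dD; last by rewrite dx in d1.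
  have ae' : a < e by move: d1; rewrite de size_row_run; lia.
  rewrite de in dD *; have [desc _ _] := row_run_spec dD ae'.
  exists e; last exact: tileP.
  by rewrite mem_filter desc mem_iota; have := row_run_lt hD dD ae; lia.
by rewrite -(tileP _ _ _ dD ae) size_row_run; split=> //; lia.
Qed.

End Trajectories.

Lemma tile_maj_row_run j a e : (a < e)%N -> tile_maj (row_run j a e) = (a + e + 1 + j)%:R.
Proof.
move=> ae; rewrite /tile_maj /tile_l leftmost_row_run size_row_run /row_square /=.
have -> : ((e - a).*2.+1 == 1)%N = false by lia.
rewrite odd_double.
have -> : ((e - a).*2.+2 = (e - a + 1) * 2)%N by lia.
have -> : ((j.*2 + 1 + false)%:Z - 1 = j%:Z * 2) by lia.
rewrite intrM natrM !mulfK //.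
by rewrite -!pmulrn -!natrD; congr _%:R; lia.
Qed.

Theorem theorem5p6 (n : nat) (hn : (1 <= n)%N) (pi : 'S_n) (hpi : avoids231 pi)
    (D : {fset tile}) (hD : dyck_tiling n D) (hDpi : tiling_perm D pi) :
  tiling_maj D = (maj_word (rho pi))%:R.
Proof.
rewrite (maj_rho_peaks hn hpi) natr_sum /tiling_maj.
rewrite (bigID (fun d : tile => size d != 1%N)) /= [X in _ + X]big1 ?addr0; last first.
  by move=> d; rewrite negbK /tile_maj => ->.
rewrite -big_filter (perm_big _ (nontrivial_tiles hD hDpi hpi)) /= big_map.
rewrite big_seq [RHS]big_seq; apply: eq_bigr => e ed.
have [a ae dD] := descent_row_run hD hDpi hpi ed.
have [_ _ ew] := row_run_spec hD hDpi hpi dD ae.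
rewrite /descent_tile ew addnK tile_maj_row_run //; congr _%:R; lia.
Qed.
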